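(* Let $m$ be a positive integer, $r$ a nonnegative integer, $\lambda\in\mathbb{R}$. For $n,k\in\mathbb{N}$ with $n\ge k$, $$W_{m,\lambda}^{(r)}(n+1,k)=W_{m,\lambda}^{(r)}(n,k-1)+(mk+r-n\lambda)W_{m,\lambda}^{(r)}(n,k).$$
   Context: $(x)_{0,\lambda}=1$, $(x)_{n,\lambda}=x(x-\lambda)\cdots(x-(n-1)\lambda)$, $(x)_n=(x)_{n,1}$. The degenerate $r$-Whitney numbers of the second kind are defined by the polynomial identities $(mx+r)_{n,\lambda}=\sum_{k=0}^n W_{m,\lambda}^{(r)}(n,k)m^k(x)_k$, $n\ge0$, with the convention $W_{m,\lambda}^{(r)}(n,k)=0$ if $k<0$ or $k>n$. *)

(* Defs.v *)
From HB Require Import structures.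
From mathcomp Require Import all_boot all_order all_algebra boolp reals.
Set Implicit Arguments.
Unset Strict Implicit.
Unset Printing Implicit Defensive.
Import Order.TTheory GRing.Theory Num.Theory.
Local Open Scope ring_scope.

(* (x)_{n,lam}, over any commutative ring so that x may be a polynomial. *)
Definition dffact (A : comNzRingType) (lam x : A) (n : nat) : A :=
  \prod_(i < n) (x - i%:R * lam).

(* W n k stands for W_{m,lam}^{(r)}(n,k); the second index is an integer so
   that the convention W(n,k) = 0 for k < 0 can be expressed. *)
Definition is_degenerate_whitney2 (R : realType) (m r : nat) (lam : R)
    (W : nat -> int -> R) : Prop :=
  (forall n : nat,
     dffact (lam%:P) (m%:R *: 'X + r%:R%:P) n =
     \sum_(k < n.+1) (W n k%:Z * m%:R ^+ k) *: dffact 1 ('X : {poly R}) k) /\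
  (forall (n : nat) (k : int), (k < 0) || (n%:Z < k) -> W n k = 0).

(* The polynomials (X)_k have size k+1 and unit leading coefficient, so the
   defining identities have exactly one solution when 0 < m. *)
Local Definition ff (R : realType) (k : nat) : {poly R} := dffact 1 'X k.

Local Lemma ffE (R : realType) k : ff R k = \prod_(i < k) ('X - (i%:R)%:P).
Proof. by rewrite /ff /dffact; apply: eq_bigr => i _; rewrite mulr1 polyC_natr. Qed.

Local Lemma ff_monic (R : realType) k : ff R k \is monic.
Proof. by rewrite ffE; apply: monic_prod => i _; apply: monicXsubC. Qed.

Local Lemma size_ff (R : realType) k : size (ff R k) = k.+1.
Proof.
by rewrite ffE size_prod_XsubC /index_enum -enumT -cardE card_ord.
Qed.

Local Lemma ff_span (R : realType) n (p : {poly R}) : (size p <= n)%N ->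
  exists c : nat -> R, p = \sum_(k < n) c k *: ff R k.
Proof.
elim: n p => [|n IH] p hp.
  by exists (fun=> 0); rewrite big_ord0; apply/eqP; rewrite -size_poly_leq0.
have /IH [c hc] : (size (p - p`_n *: ff R n)%R <= n)%N.
  apply/leq_sizeP => j hj; rewrite coefB coefZ.
  have [<-|nj] := eqVneq n j.
    have := monicP (ff_monic R n); rewrite lead_coefE size_ff => ->.
    by rewrite mulr1 subrr.
  have lt_nj : (n < j)%N by rewrite ltn_neqAle nj hj.
  rewrite (nth_default _ (leq_trans hp lt_nj)).
  by rewrite [(ff R n)`_j]nth_default ?size_ff // mulr0 subrr.
exists (fun k => if k == n then p`_n else c k).
rewrite big_ord_recr /= eqxx -[LHS](subrK (p`_n *: ff R n)) hc; congr (_ + _).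
by apply: eq_bigr => i _; rewrite (ltn_eqF (ltn_ord i)).
Qed.

Local Lemma ff_free (R : realType) n (c : nat -> R) : \sum_(k < n) c k *: ff R k = 0 ->
  forall k, (k < n)%N -> c k = 0.
Proof.
elim: n => // n IH; rewrite big_ord_recr /= => h.
have cn0 : c n = 0.
  have := congr1 (fun q : {poly R} => q`_n) h.
  rewrite coefD coefZ coef0 coef_sum big1 => [|i _]; last first.
    by rewrite coefZ nth_default ?mulr0 // size_ff.
  have := monicP (ff_monic R n); rewrite lead_coefE size_ff => ->.
  by rewrite add0r mulr1.
move: h; rewrite cn0 scale0r addr0 => /IH h k.
by rewrite ltnS leq_eqVlt => /orP[/eqP->|/h].
Qed.

Lemma degenerate_whitney2_exists (R : realType) (m r : nat) (lam : R) : (0 < m)%N ->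
  exists W, is_degenerate_whitney2 m r lam W.
Proof.
move=> m0; have mu k : (m%:R ^+ k : R) != 0 by rewrite expf_neq0 // pnatr_eq0 -lt0n.
pose p n := dffact lam%:P (m%:R *: 'X + r%:R%:P : {poly R}) n.
have size_p n : (size (p n) <= n.+1)%N.
  rewrite /p /dffact; elim: n => [|n IH]; first by rewrite big_ord0 size_poly1.
  rewrite big_ord_recr /=; apply: leq_trans (size_polyMleq _ _) _.
  rewrite -subn1 leq_subLR add1n -addn2; apply: leq_add => //.
  rewrite -polyC_natr -polyCM -addrA -polyCB.
  apply: leq_trans (size_polyD _ _) _; rewrite geq_max.
  rewrite (leq_trans (size_scale_leq _ _)) ?size_polyX //=.
  by rewrite (leq_trans (size_polyC_leq1 _)).
have hc n : {c : nat -> R | p n = \sum_(k < n.+1) c k *: ff R k}.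
  exact/cid/ff_span.
exists (fun n k => if k is Posz j then
  if (j <= n)%N then sval (hc n) j / m%:R ^+ j else 0 else 0); split=> [n|n [j|j]//].
  rewrite -/(p n) {1}(svalP (hc n)); apply: eq_bigr => i _.
  by rewrite -ltnS ltn_ord divfK.
by rewrite ltz_nat /=; case: leqP.
Qed.

Lemma degenerate_whitney2_unique (R : realType) (m r : nat) (lam : R) W W' : (0 < m)%N ->
  is_degenerate_whitney2 m r lam W -> is_degenerate_whitney2 m r lam W' ->
  forall n k, W n k = W' n k.
Proof.
move=> m0 [h h0] [h' h0'] n k.
case: (boolP ((k < 0) || (n%:Z < k))) => [hk|]; first by rewrite h0 ?h0'.
case: k => [k|//]; rewrite ltz_nat /= -leqNgt => kn.
have mk : (m%:R ^+ k : R) != 0 by rewrite expf_neq0 // pnatr_eq0 -lt0n.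
apply: (mulIf mk); apply/eqP; rewrite -subr_eq0; apply/eqP.
apply: (@ff_free R n.+1 (fun k => W n k%:Z * m%:R ^+ k - W' n k%:Z * m%:R ^+ k)) => //.
under eq_bigr do rewrite scalerBl.
by rewrite sumrB -h -h' subrr.
Qed.

(* Main.v *)
Require Import Defs.
From mathcomp Require Import all_boot all_order all_algebra reals.
From mathcomp Require Import zify ring.
Import Order.TTheory GRing.Theory Num.Theory.
Local Open Scope ring_scope.

(** Multiplying the identity for [n] by [m X + r - n lam], and writing this
    factor as [m (X - k) + (m k + r - n lam)] in the [k]-th term, expands the
    left-hand side of the identity for [n + 1] with the coefficients predicted
    by the recurrence.  The array given by the recurrence thus satisfies the
    defining identities, and uniqueness of their solution concludes. *)

Lemma dffactS (A : comNzRingType) (lam x : A) (n : nat) :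
  dffact lam x n.+1 = dffact lam x n * (x - n%:R * lam).
Proof. by rewrite /dffact big_ord_recr. Qed.

Section Recurrence.

Context (R : realType) (m r : nat) (lam : R) (W : nat -> int -> R).

(** Each row is computed from the previous row of [W] itself, not recursively, so the identity for
    [W] applies directly. *)
Definition whitney2_rec (n : nat) (k : int) : R :=
  if n is n'.+1 then
    W n' (k - 1) + (m%:R * k%:~R + r%:R - n'%:R * lam) * W n' k
  else W 0 k.

Lemma dffact_mul_shift (n k : nat) :
  dffact 1 ('X : {poly R}) k * (m%:R *: 'X + r%:R%:P - n%:R * lam%:P) =
  m%:R *: dffact 1 'X k.+1 +
  (m%:R * k%:R + r%:R - n%:R * lam) *: dffact 1 'X k.
Proof.
rewrite dffactS -!mul_polyC !(polyCD, polyCN, polyCM, polyC_natr).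
ring.
Qed.

Lemma whitney2_recP :
  is_degenerate_whitney2 m r lam W -> is_degenerate_whitney2 m r lam whitney2_rec.
Proof.
move=> [hW W0]; split=> [[|n]|[|n] k hk /=]; [exact: hW| |exact: W0|].
- rewrite dffactS hW mulr_suml.
  under eq_bigr => k _ do
    rewrite -scalerAl dffact_mul_shift scalerDr !scalerA -mulrA -exprSr.
  rewrite big_split /=.
  under [RHS]eq_bigr do rewrite mulrDl scalerDl.
  rewrite [RHS]big_split /=; congr (_ + _).
    (* The term of index 0 carries [W n (-1)], which is zero; the rest is a shift by one. *)
    rewrite [RHS]big_ord_recl /= (W0 n (0%:Z - 1)) // mul0r scale0r add0r.
    by apply: eq_bigr => k _; rewrite /bump leq0n add1n intS addrAC subrr add0r.
  (* The extra top term carries [W n n.+1], zero by convention. *)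
  rewrite [RHS]big_ord_recr /= (W0 n n.+1%:Z) ?ltz_nat ?ltnSn ?orbT //.
  rewrite mulr0 mul0r scale0r addr0; apply: eq_bigr => k _; congr (_ *: _).
  by rewrite mulrC mulrA.
(* If [k] is outside row [n.+1], both [k - 1] and [k] are outside row [n]. *)
- by rewrite !W0 ?mulr0 ?addr0 //; lia.
Qed.

End Recurrence.

Theorem theorem7 (R : realType) (m r : nat) (lam : R) (W : nat -> int -> R)
    (hm : (0 < m)%N) (hW : is_degenerate_whitney2 m r lam W)
    (n k : nat) (hkn : (k <= n)%N) :
  W n.+1 k%:Z =
    W n (k%:Z - 1) + (m%:R * k%:R + r%:R - n%:R * lam) * W n k%:Z.
Proof. exact: degenerate_whitney2_unique hm hW (whitney2_recP _ _ _ _ _ hW) n.+1 k. Qed.
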